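(* Let $M$, $N$ be Riemannian manifolds, $g:M\to N$, $f:N\to (-\infty,\infty]$, and $p\in M$. Assume that the function $f$ is subdifferentiable at $g(p)$, and that $g$ is Fréchet differentiable at $p$. Then the composition $f\circ g:M\to(-\infty,\infty]$ is subdifferentiable at $p$, and $$\{\zeta\circ dg(p) : \zeta\in D^{-}f(g(p))\}\subseteq D^{-}(f\circ g)(p).$$
   Context: A Riemannian manifold is a $C^\infty$ manifold modelled on a Hilbert space (possibly infinite-dimensional) with a $C^\infty$ assignment of scalar products on the tangent spaces inducing equivalent norms. For a function $f:M\to(-\infty,\infty]$ and a point $p$ with $f(p)<\infty$, the subdifferential $D^{-}f(p)\subset T^*M_p$ is the set of all $d\varphi(p)$ with $\varphi\in C^1(M,\mathbb{R})$ such that $f-\varphi$ attains a local minimum at $p$; $f$ is subdifferentiable at $p$ if $f(p)<\infty$ and $D^{-}f(p)\neq\emptyset$. *)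

(* Defs.v *)
From HB Require Import structures.
From mathcomp Require Import all_boot all_order all_algebra.
From mathcomp Require Import all_classical all_reals all_analysis.

Set Implicit Arguments.
Unset Strict Implicit.
Unset Printing Implicit Defensive.
Import Order.TTheory GRing.Theory Num.Theory.
Import numFieldNormedType.Exports.

Local Open Scope classical_set_scope.
Local Open Scope ring_scope.

(** * Hilbert spaces *)

HB.mixin Record CompleteNormedModule_isHilbert (R : realType) E
    & CompleteNormedModule R E := {
  hdot : {dot E for (@idfun R)} ;
  hdotE : forall x : E, hdot x x = `|x| ^+ 2
}.

#[short(type="hilbertType")]
HB.structure Definition Hilbert (R : realType) :=
  {E of CompleteNormedModule R E & CompleteNormedModule_isHilbert R E}.

(** * The normed space of continuous linear maps *)

Section ContinuousLinear.
Variables (R : realType) (E F : normedModType R).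

Definition clin_pred : {pred E -> F} :=
  fun f => `[< linear f /\ continuous f >].

Fact clin_submod_closed : submod_closed clin_pred.
Proof.
split=> [|a f g].
  apply/asboolP; split=> [b x y|x]; last exact: cst_continuous.
  by rewrite /GRing.zero /= scaler0 addr0.
move=> /asboolP[lf cf] /asboolP[lg cg]; apply/asboolP; split.
  have fgE z : (a *: f + g) z = a *: f z + g z by [].
  by move=> b x y; rewrite !fgE lf lg !scalerDr !scalerA (mulrC a b) addrACA.
move=> x; apply: (@cvgD _ _ _ _ _ (a \*: f) g); last exact: cg.
exact: (cvgZl_tmp (cf x)).
Qed.

HB.instance Definition _ :=
  GRing.isSubmodClosed.Build R (E -> F) clin_pred clin_submod_closed.

Record clin := Clin { clin_fun :> E -> F ; _ : clin_fun \in clin_pred }.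

HB.instance Definition _ := [isSub for clin_fun].
HB.instance Definition _ := [Choice of clin by <:].
HB.instance Definition _ := [SubChoice_isSubLmodule of clin by <:].

Lemma clin_linear (f : clin) : linear f.
Proof. by have /asboolP[] := valP f. Qed.

Lemma clin_continuous (f : clin) : continuous f.
Proof. by have /asboolP[] := valP f. Qed.

HB.instance Definition _ (f : clin) :=
  GRing.isLinear.Build R E F _ f (clin_linear f).

Definition opnorm (f : clin) : R := sup [set `|f x| | x in [set x | `|x| <= 1]].

Lemma opnorm_has_sup (f : clin) :
  has_sup [set `|f x| | x in [set x | `|x| <= 1]].
Proof.
split; first by exists `|f 0|, 0 => //=; rewrite normr0.
have /linear_boundedP := continuous_linear_bounded 0 (@clin_continuous f 0).
move=> /pinfty_ex_gt0[M M0 fM]; exists M => _ [x /= x1 <-].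
by rewrite (le_trans (fM x))// ler_piMr// ltW.
Qed.

Lemma le_opnorm (f : clin) x : `|f x| <= opnorm f * `|x|.
Proof.
have [->|x0] := eqVneq x 0; first by rewrite linear0 !normr0 mulr0.
rewrite -ler_pdivrMr ?normr_gt0//.
apply: (ub_le_sup (opnorm_has_sup f).2); exists (`|x|^-1 *: x) => /=.
  by rewrite normrZ normfV normr_id mulVf// normr_eq0.
by rewrite linearZ normrZ normfV normr_id mulrC.
Qed.

Lemma opnorm_le (f : clin) M :
  (forall x, `|x| <= 1 -> `|f x| <= M) -> opnorm f <= M.
Proof.
move=> fM; apply: ge_sup; first exact: (opnorm_has_sup f).1.
by move=> _ [x /= x1 <-]; exact: fM.
Qed.

Fact opnormD (f g : clin) : opnorm (f + g) <= opnorm f + opnorm g.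
Proof.
apply: opnorm_le => x x1; rewrite /= (le_trans (ler_normD _ _))//.
by rewrite lerD// ub_le_sup//; [exact: (opnorm_has_sup _).2|exists x
                               |exact: (opnorm_has_sup _).2|exists x].
Qed.

Fact opnormZ (a : R) (f : clin) : opnorm (a *: f) = `|a| * opnorm f.
Proof.
have le b (h : clin) : opnorm (b *: h) <= `|b| * opnorm h.
  apply: opnorm_le => x x1; rewrite [leLHS]normrZ ler_wpM2l//.
  by rewrite ub_le_sup//; [exact: (opnorm_has_sup _).2|exists x].
apply/eqP; rewrite eq_le le/=; have [->|a0] := eqVneq a 0.
  rewrite normr0 mul0r; apply: (le_trans (normr_ge0 ((0 *: f) 0))).
  rewrite ub_le_sup//; [exact: (opnorm_has_sup _).2|].
  by exists 0 => //=; rewrite normr0.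
by rewrite -ler_pdivlMl ?normr_gt0// -normfV -{1}[f](scalerK a0) le.
Qed.

Fact opnorm_eq0 (f : clin) : opnorm f = 0 -> f = 0.
Proof.
move=> f0; apply/val_inj/funext => x /=; apply/normr0_eq0/eqP.
by rewrite eq_le normr_ge0 andbT (le_trans (le_opnorm f x))// f0 mul0r.
Qed.

HB.instance Definition _ :=
  Lmodule_isNormed.Build R clin opnormD opnormZ opnorm_eq0.

End ContinuousLinear.

(** * Maps of class C^k *)

Section DifferentiabilityClasses.
Variables (R : realType) (E : normedModType R).

(* [U] is meant to be open; values of [f] outside [U] are irrelevant. *)
Fixpoint Ck (k : nat) : forall F : normedModType R, set E -> (E -> F) -> Prop :=
  if k is k'.+1 then fun F U f =>
    exists2 f' : E -> clin E F,
      forall x, U x -> is_diff x f (f' x) & Ck k' U f'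
  else fun F U f => forall x, U x -> {for x, continuous f}.

Definition smooth (F : normedModType R) (U : set E) (f : E -> F) :=
  forall k, Ck k U f.

End DifferentiabilityClasses.

Lemma near_eq_is_diff (R : realType) (E F : normedModType R) (f g : E -> F) x :
  {near x, f =1 g} -> differentiable f x -> is_diff x g ('d f x).
Proof.
move=> fg df; pose h := g - f.
have h0 : \forall y \near x, h y = 0.
  by apply: filterS fg => y fgy; rewrite /h fctE -fgy subrr.
have hx : h x = 0 := nbhs_singleton h0.
have ho : h \o shift x = cst (h x) + \0 +o_ 0 id.
  apply/eqaddoP => e e0; rewrite near_simpl; near=> y.
  rewrite !fctE /= hx add0r subr0.
  suff -> : h (y + x) = 0 by rewrite normr0 mulr_ge0// ltW.
  near: y.
  have /(_ _ h0) : (y + x) @[y --> (0 : E)] --> x.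
    by rewrite -[X in _ --> X]add0r; apply: cvgD; [exact: cvg_id|exact: cvg_cst].
  by [].
have h0c : continuous (\0 : E -> F) by exact: cst_continuous.
have dh : is_diff x h \0.
  split; last exact: (diff_unique h0c ho).
  by apply/diff_locallyP; rewrite (diff_unique h0c ho).
have -> : g = f + h by rewrite /h addrC subrK.
split; first by apply: differentiableD => //; exact: ex_diff.
rewrite diffD//; apply/funext => y.
rewrite -[LHS]/('d f x y + 'd h x y).
by have -> : 'd h x = \0 :> (E -> F) := diff_val; rewrite addr0.
Unshelve. all: by end_near. Qed.

Lemma near_diff_comp (R : realType) (E F G : normedModType R) (f : E -> F)
    (g : F -> G) (h : E -> G) x y v :
  f x = y -> differentiable f x -> differentiable g y ->
  {near x, g \o f =1 h} -> 'd h x v = 'd g y ('d f x v).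
Proof.
move=> <- df dg gfh.
have /(congr1 (@^~ v)) -> :=
  @diff_val _ _ _ _ _ _ _ (near_eq_is_diff gfh (differentiable_comp df dg)).
exact: (congr1 (@^~ v) (diff_comp df dg)).
Qed.

(** * Hilbert manifolds *)

(* A chart is a homeomorphism from the open set [cdom] onto an open subset of
   the model space; both it and its inverse are total functions whose values
   elsewhere are irrelevant. *)
Record chart (R : realType) (M : topologicalType) (E : normedModType R) :=
  Chart {
    cfun :> M -> E ;
    cinv : E -> M ;
    cdom : set M ;
    cdom_open : open cdom ;
    cimg_open : open (cfun @` cdom) ;
    cfunK : forall q, cdom q -> cinv (cfun q) = q ;
    cfun_continuous : forall q, cdom q -> {for q, continuous cfun} ;
    cinv_continuous : forall x, (cfun @` cdom) x -> {for x, continuous cinv}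
  }.

Record manifold (R : realType) := Manifold {
  points :> topologicalType ;
  model : hilbertType R ;
  atlas : set (chart points model) ;
  points_hausdorff : hausdorff_space points ;
  atlas_cover : forall p, exists2 c, atlas c & cdom c p ;
  atlas_smooth : forall c d, atlas c -> atlas d ->
    smooth (c @` (cdom c `&` cdom d)) (d \o cinv c)
}.

Section TangentSpace.
Variables (R : realType) (M : manifold R).
Local Notation E := (model M).

Definition chart_at (p : M) := {c : chart M E | atlas c /\ cdom c p}.

Definition chart_of p (c : chart_at p) : chart M E := sval c.
Local Coercion chart_of : chart_at >-> chart.

Definition some_chart (p : M) : chart_at p :=
  let: exist2 c ac cp := cid2 (atlas_cover p) in exist _ c (conj ac cp).

Definition transition p (c d : chart_at p) : {linear E -> E} :=
  'd (d \o cinv c) (c p).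

Lemma transition_differentiable p (c d : chart_at p) :
  differentiable (d \o cinv c) (c p).
Proof.
have [[ac cp] [ad dp]] := (svalP c, svalP d).
have [f' df' _] := atlas_smooth ac ad 1.
by have [] := df' (c p) (ex_intro2 _ _ p (conj cp dp) erefl).
Qed.

Lemma near_chart p (c : chart_at p) (P : set M) :
  nbhs p P -> \forall x \near c p, P (cinv c x).
Proof.
have [_ cp] := svalP c => pP.
have cc := @cinv_continuous _ _ _ c (c p) (ex_intro2 _ _ p cp erefl).
by apply: cc; rewrite cfunK.
Qed.

Lemma near_cdom p (c : chart_at p) : \forall q \near p, cdom c q.
Proof.
have [_ cp] := svalP c; apply: open_nbhs_nbhs.
by split=> //; exact: cdom_open.
Qed.

Lemma transition_comp p (c d e : chart_at p) v :
  transition d e (transition c d v) = transition c e v.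
Proof.
have [_ cp] := svalP c; apply/esym/near_diff_comp.
- by rewrite /= cfunK.
- exact: transition_differentiable.
- exact: transition_differentiable.
- by apply: filterS (near_chart c (near_cdom d)) => x dx /=; rewrite (cfunK dx).
Qed.

(* A tangent vector at [p] is given by its coordinates in all the charts at
   [p], related by the derivatives of the changes of charts. *)
Definition tangent_pred (p : M) : {pred chart_at p -> E} :=
  fun v => `[< forall c d, v d = transition c d (v c) >].

Fact tangent_submod_closed p : submod_closed (@tangent_pred p).
Proof.
split=> [|a u v]; first by apply/asboolP => c d; rewrite /GRing.zero /= linear0.
move=> /asboolP tu /asboolP tv; apply/asboolP => c d.
have uvE e : (a *: u + v) e = a *: u e + v e by [].
by rewrite !uvE (tu c d) (tv c d) linearP.
Qed.

HB.instance Definition _ p := GRing.isSubmodClosed.Build R (chart_at p -> E)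
  (@tangent_pred p) (tangent_submod_closed p).

Record tangent (p : M) :=
  Tangent { coord :> chart_at p -> E ; _ : coord \in @tangent_pred p }.

HB.instance Definition _ p := [isSub for @coord p].
HB.instance Definition _ p := [Choice of tangent p by <:].
HB.instance Definition _ p := [SubChoice_isSubLmodule of tangent p by <:].

Definition tvec_coord p (c : chart_at p) (x : E) : chart_at p -> E :=
  fun d => transition c d x.

Fact tvec_subproof p (c : chart_at p) x : tvec_coord c x \in @tangent_pred p.
Proof. by apply/asboolP => d e; rewrite /tvec_coord transition_comp. Qed.

(* The tangent vector with coordinate [x] in the chart [c]. *)
Definition tvec p (c : chart_at p) (x : E) : tangent p :=
  Tangent (tvec_subproof c x).

Lemma tvecE p (c : chart_at p) x : tvec c x c = x.
Proof.
have [_ cp] := svalP c.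
have cx : {near c p, id =1 c \o cinv c}.
  have := open_nbhs_nbhs (conj (@cimg_open _ _ _ c) (ex_intro2 _ _ p cp erefl)).
  by apply: filterS => y [q cq <-] /=; rewrite cfunK.
have [_ h] := near_eq_is_diff cx (@ex_diff _ _ _ _ _ _ _ (is_diff_id _)).
rewrite [LHS](congr1 (@^~ x) h).
exact: (congr1 (@^~ x) (@diff_val _ _ _ _ _ _ _ (is_diff_id _))).
Qed.

End TangentSpace.

Coercion chart_of : chart_at >-> chart.

(** * Differentials *)

Section Differentials.
Variables (R : realType) (M N : manifold R).

(* Continuity of [g] at [p] is what makes its expression in charts a function
   defined near the image of [p]. *)
Definition mdifferentiable (g : M -> N) (p : M) :=
  {for p, continuous g} /\
  forall (c : chart_at p) (d : chart_at (g p)),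
    differentiable (d \o g \o cinv c) (c p).

(* The differential of [g] at [p]; by [mdiffE] it does not depend on the charts
   used here. *)
Definition mdiff (g : M -> N) (p : M) (v : tangent p) : tangent (g p) :=
  let c := some_chart p in let d := some_chart (g p) in
  tvec d ('d (d \o g \o cinv c) (c p) (v c)).

Lemma mdiffE (g : M -> N) (p : M) (v : tangent p) (c : chart_at p)
    (d : chart_at (g p)) : mdifferentiable g p ->
  @mdiff g p v d = 'd (d \o g \o cinv c) (c p) (v c).
Proof.
move=> [gc dg]; set c0 := some_chart p; set d0 := some_chart (g p).
have [_ cp] := svalP c; have [_ c0p] := svalP c0.
have vc0 : v c0 = transition c c0 (v c) by have /asboolP := valP v; apply.
have e1 : (c0 \o cinv c) (c p) = c0 p by rewrite /= (cfunK cp).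
have D1 := transition_differentiable c c0.
have gcd0 : \forall q \near p, cdom c0 q /\ cdom d0 (g q).
  by apply: filterI (near_cdom c0) _; exact: gc (near_cdom d0).
have D2 : differentiable (d0 \o g \o cinv c) (c p) by exact: dg.
have h1 : 'd (d0 \o g \o cinv c) (c p) (v c) =
    'd (d0 \o g \o cinv c0) (c0 p) (v c0).
  rewrite vc0; apply: (near_diff_comp _ e1 D1 (dg c0 d0)).
  apply: filterS (near_chart c gcd0) => x [c0x _] /=.
  by rewrite (cfunK c0x).
have e2 : (d0 \o g \o cinv c) (c p) = d0 (g p) by rewrite /= (cfunK cp).
rewrite (near_diff_comp _ e2 D2 (transition_differentiable d0 d)) ?h1//.
apply: filterS (near_chart c gcd0) => x [_ d0x] /=.
by rewrite (cfunK d0x).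
Qed.

End Differentials.

Arguments mdiff {R M N} g p v.

Section ScalarDifferentials.
Variables (R : realType) (M : manifold R).

Definition mC1 (phi : M -> R) :=
  forall c, atlas c -> Ck 1 (c @` cdom c) (phi \o cinv c : model M -> R^o).

Definition sdiff (phi : M -> R) (p : M) (v : tangent p) : R :=
  let c := some_chart p in
  'd (phi \o cinv c : model M -> R^o) (c p) (v c).

Lemma sdiffE (phi : M -> R) (p : M) (v : tangent p) (c : chart_at p) :
  mC1 phi -> @sdiff phi p v = 'd (phi \o cinv c : model M -> R^o) (c p) (v c).
Proof.
set c0 := some_chart p => /(_ (sval c0)).
have [_ cp] := svalP c; have [ac0 c0p] := svalP c0.
move=> /(_ ac0)[f' df _].
have vc0 : v c0 = transition c c0 (v c) by have /asboolP := valP v; apply.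
rewrite /sdiff -/c0 vc0; apply/esym/near_diff_comp.
- by rewrite /= (cfunK cp).
- exact: transition_differentiable.
- by have [] := df (c0 p) (ex_intro2 _ _ p c0p erefl).
- by apply: filterS (near_chart c (near_cdom c0)) => x c0x /=; rewrite (cfunK c0x).
Qed.

End ScalarDifferentials.

Arguments sdiff {R M} phi p v.

(** * Riemannian manifolds *)

(* [metric_smooth]: the local expression of the metric in a chart is a C^oo map
   into the Banach space of continuous bilinear forms on the model space. *)
Record riemannian (R : realType) := Riemannian {
  rmanifold :> manifold R ;
  metric : forall p : rmanifold, {dot (tangent p) for (@idfun R)} ;
  metric_equiv : forall (p : rmanifold) (c : chart_at p),
    exists a b : R, [/\ 0 < a, 0 < b & forall v : tangent p,
      a * `|v c| <= Num.sqrt (metric p v v) <= b * `|v c|] ;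
  metric_smooth : forall c : chart rmanifold (model rmanifold), atlas c ->
    exists2 G : model rmanifold -> clin (model rmanifold)
                                        (clin (model rmanifold) R^o),
      smooth (c @` cdom c) G &
      forall (p : rmanifold) (d : chart_at p), chart_of d = c ->
      forall u v : tangent p, metric p u v = G (c p) (u d) (v d)
}.

(** * Subdifferentials *)

(* Covectors at [p] are represented by their values on [tangent p]; those in
   the subdifferential are differentials of C^1 functions, hence linear and
   continuous.  Meaningful when [f p] is finite. *)

Section Subdifferential.
Variables (R : realType) (M : riemannian R).
Local Open Scope ereal_scope.

Definition subdifferential (f : M -> \bar R) (p : M) : set (tangent p -> R) :=
  [set zeta | exists phi : M -> R, [/\ mC1 phi,
    \forall q \near p, f p - (phi p)%:E <= f q - (phi q)%:E &
    zeta = sdiff phi p]].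
Arguments subdifferential f p : clear implicits.

Definition subdifferentiable (f : M -> \bar R) (p : M) :=
  f p < +oo /\ subdifferential f p !=set0.

End Subdifferential.

Arguments subdifferential {R M} f p.

(* Main.v *)
From HB Require Import structures.
Require Import Defs.
From mathcomp Require Import all_boot all_order all_algebra.
From mathcomp Require Import all_classical all_reals all_analysis.
From mathcomp Require Import ring lra.

Set Implicit Arguments.
Unset Strict Implicit.
Unset Printing Implicit Defensive.
Import Order.TTheory GRing.Theory Num.Theory.
Import numFieldNormedType.Exports.

Local Open Scope classical_set_scope.
Local Open Scope ring_scope.

(** Let zeta = d phi with phi of class C^1 on N and f - phi locally minimal at
    g p.  Since g is continuous at p, the function f o g - phi o g is locally
    minimal at p, and the chain rule gives d (phi o g) (p) = zeta o dg(p)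
    ([mC1_comp_diff]).  What is missing is regularity: phi o g is only
    differentiable at p.  It is therefore replaced by a function psi of class
    C^1 on M with the same value and the same differential at p and with
    psi <= phi o g near p ([C1_touching_below]); then f o g - psi is still
    locally minimal at p.

    In a chart the function psi is found as follows ([C1_minorant]).  Let h be
    differentiable at a, with affine part A.  The remainder is o(|x - a|), and
    every such remainder is dominated by sigma (|x - a|) for some C^1 function
    sigma with sigma 0 = sigma' 0 = 0 ([C1_modulus]); since the norm of a
    Hilbert space is differentiable off the origin, x |-> sigma (|x - a|) is of
    class C^1, with zero differential at a.  Up to a cutoff, A - sigma(|x - a|)
    is the required function.

    It remains to transport the function to M, extending it by zero outside
    the chart.  This is of class C^1 provided that the closure in M of a small
    ball of the chart stays inside the domain of the chart.  In infinite
    dimension balls are not compact, and a Hausdorff manifold modelled on a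
    Hilbert space need not be regular; the Riemannian metric is what
    forces regularity ([chart_separation]).  A point q outside the domain of
    the chart c, but in the closure of a small ball, would be joined to points
    of this ball by arbitrarily short segments in a chart around q.  The metric
    makes the images of these segments under c short as well, hence they stay
    in a slightly larger ball and have a limit there by completeness; as M is
    Hausdorff, this limit must represent q. *)

(** * First-order estimates and functions of one real variable *)

Lemma is_diff_near (R : realType) (E F : normedModType R) (f df : E -> F) x :
  is_diff x f df -> forall e : R, 0 < e ->
  \forall y \near x, `|f y - f x - df (y - x)| <= e * `|y - x|.
Proof.
move=> [dfx <-] e e0.
have /eqaddoP /(_ e e0) := diff_locally dfx; rewrite near_simpl => H.
rewrite (near_shift 0) subr0; apply: filterS H => y.
by rewrite !fctE /= addrK opprD addrA.
Qed.

(** The converse of [is_diff_near]: it reduces the computation of a differential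
    to an estimate, with no Landau symbol left. *)
Lemma near_is_diff (R : realType) (E F : normedModType R) (f : E -> F)
    (df : {linear E -> F}) x : continuous df ->
  (forall e : R, 0 < e ->
     \forall y \near x, `|f y - f x - df (y - x)| <= e * `|y - x|) ->
  is_diff x f df.
Proof.
move=> cdf fdf.
have fE : f \o shift x = cst (f x) + df +o_ 0 id.
  apply/eqaddoP => e e0; rewrite near_simpl.
  have := fdf e e0; rewrite (near_shift 0) subr0; apply: filterS => y /=.
  by rewrite !fctE /= addrK opprD addrA.
have dE := diff_unique cdf fE.
by split => //; apply/diff_locallyP; rewrite dE.
Qed.

Lemma is_derive_is_diff (R : realType) (f : R -> R) (t a : R) :
  is_derive t 1 f a -> is_diff t (f : R -> R^o) ( *%R a : R -> R^o).
Proof.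
move=> [df <-]; split; first exact/derivable1_diffP.
by rewrite deriv1E//; apply/funext => v; rewrite derive1E mulrC.
Qed.

Lemma pos_sqr_taylor (R : realType) (u s : R) :
  `|Num.max 0 u ^+ 2 - Num.max 0 s ^+ 2 - 2 * Num.max 0 s * (u - s)| <=
  `|u - s| * `|u - s|.
Proof.
rewrite -normrM -expr2 [leRHS]ger0_norm ?sqr_ge0// ler_norml.
have us0 := sqr_ge0 (u - s).
by apply/andP; split; case: (leP 0 u) => u0; case: (leP 0 s) => s0; nra.
Qed.

(** This is the one-variable C^1 profile, constant on a half-line, from which
    cutoff functions are made. *)
Lemma is_diff_pos_sqr (R : realType) (s : R) :
  is_diff s (fun u => Num.max 0 u ^+ 2 : R^o)
    ( *%R (2 * Num.max 0 s) : R -> R^o).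
Proof.
apply: (@near_is_diff _ _ _ _ ( *:%R (2 * Num.max 0 s))).
  by move=> x; apply: cvgZl_tmp; exact: cvg_id.
move=> e e0; near=> u; have ue : `|u - s| <= e.
  near: u; apply/nbhs_ballP; exists e => //= u.
  by rewrite /ball/= distrC => /ltW.
apply: (@le_trans _ _ (`|u - s| * `|u - s|)); last exact: ler_wpM2r.
exact: pos_sqr_taylor.
Unshelve. all: by end_near. Qed.

Lemma antiderivative (R : realType) (f : R -> R) : continuous f ->
  exists2 F : R -> R, F 0 = 0 & forall t : R, 0 <= t -> is_derive t 1 F (f t).
Proof.
move=> cf.
(* Starting at -1 makes 0 interior, so that G is differentiable there too. *)
pose G (x : R) := (\int[lebesgue_measure]_(t in `[(-1)%R, x]) (f t))%R.
have dG (t : R) : 0 <= t -> is_derive t 1 G (f t).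
  move=> t0.
  have [||||dG G't] := @continuous_FTC1_closed R f (-1) t (t + 1).
  - by rewrite ltrDl.
  - apply: continuous_compact_integrable; first exact: segment_compact.
    exact: continuous_subspaceT.
  - by lra.
  - exact: cf.
  by split; [exact: dG | rewrite -derive1E].
exists (fun x => G x - G 0) => [|t t0]; first by rewrite subrr.
have -> : f t = f t - 0 by rewrite subr0.
by have := dG t t0 => ?; apply: is_deriveB.
Qed.

Section Modulus.
Variables (R : realType) (T : Type) (k n : T -> R).
Hypothesis n_ge0 : forall x, 0 <= n x.
Hypothesis ko : forall e : R, 0 < e ->
  exists2 d, 0 < d & forall x, n x < d -> k x <= e * n x.

(** The positive slopes k x / n x tend to 0 as n x does.  Let tau t be the
    supremum over x of the slope at x times min (1, t / n x).  At t = n x this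
    is at least the slope at x; it tends to 0 with t, because the points with
    n x bounded below contribute O(t); and tau t / t is nonincreasing while tau
    is nondecreasing, which makes tau continuous away from 0.  Let F be a
    primitive of tau and sigma t = F (2 t): as F' = tau is at least tau t on
    [t, 2 t], one has sigma t >= t tau t. *)
Lemma C1_modulus : exists sigma tau : R -> R,
  [/\ forall t : R, 0 <= t -> is_derive t 1 sigma (tau t),
      continuous tau, tau 0 = 0, sigma 0 = 0 &
      exists2 d, 0 < d & forall x, n x < d -> k x <= sigma (n x)].
Proof.
have [d d0 kd] := ko ltr01.
pose I x := [/\ 0 < n x, n x < d & 0 <= k x].
pose w (t : R) x := k x / n x * Num.min 1 (`|t| / n x).
pose S (t : R) := [set z : R | z = 0 \/ exists2 x, I x & z = w t x].
pose tau (t : R) := sup (S t).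
have w1 t x : I x -> w t x <= 1.
  move=> [nx0 nxd kx0]; rewrite /w mulr_ile1 ?divr_ge0 ?(ltW nx0)//.
  - by rewrite le_min ler01 divr_ge0 ?(ltW nx0).
  - by rewrite ler_pdivrMr// kd.
  - by rewrite ge_min lexx.
have supS t : has_sup (S t).
  split; first by exists 0; left.
  by exists 1 => _ [->|[x Ix ->]]; [exact: ler01|exact: w1].
(* The value 0 in S t makes the supremum meaningful when I is empty. *)
have tau_ge0 t : 0 <= tau t by apply: ub_le_sup; [case: (supS t)|left].
have tau_ub t x : I x -> w t x <= tau t.
  by move=> Ix; apply: ub_le_sup; [case: (supS t)|right; exists x].
have tau_le t B : 0 <= B -> (forall x, I x -> w t x <= B) -> tau t <= B.
  move=> B0 wB; apply: ge_sup; first by case: (supS t).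
  by move=> _ [->|[x Ix ->]] //; exact: wB.
have tau_le1 t : tau t <= 1 by apply: tau_le => // x; exact: w1.
have kn_ge0 x : I x -> 0 <= k x / n x.
  by move=> [/ltW ? _ ?]; rewrite divr_ge0.
have tau_mono s t : `|s| <= `|t| -> tau s <= tau t.
  move=> st; apply: tau_le => // x Ix; apply: le_trans (tau_ub t x Ix).
  have [nx0 _ _] := Ix.
  rewrite ler_wpM2l ?kn_ge0// le_min ge_min lexx/= ge_min.
  by rewrite ler_pM2r ?invr_gt0// st orbT.
have tau_scale s t : 0 < `|s| -> `|s| <= `|t| -> tau t <= `|t| / `|s| * tau s.
  move=> s0 st; apply: tau_le => [|x Ix]; first by rewrite mulr_ge0// divr_ge0.
  apply: le_trans (ler_wpM2l _ (tau_ub s x Ix)); last by rewrite divr_ge0.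
  have [nx0 _ _] := Ix.
  rewrite /w mulrCA ler_wpM2l ?kn_ge0// minr_pMr ?divr_ge0// mulr1.
  rewrite mulrA divfK ?gt_eqF// le_min !ge_min lexx orbT andbT.
  by rewrite ler_pdivlMr// mul1r st.
have tau_lip s t : 0 < `|s| -> `|s| <= `|t| ->
    `|tau s - tau t| <= `|s - t| / `|s|.
  move=> s0 st; rewrite ler0_norm ?subr_le0 ?tau_mono// opprB.
  apply: (@le_trans _ _ ((`|t| / `|s| - 1) * tau s)).
    by rewrite mulrBl mul1r lerB// tau_scale.
  apply: (@le_trans _ _ (`|t| / `|s| - 1)).
    by rewrite ler_piMr ?tau_le1// subr_ge0 ler_pdivlMr// mul1r.
  rewrite ler_pdivlMr// mulrBl divfK ?gt_eqF// mul1r.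
  by rewrite distrC (le_trans (ler_norm _))// ler_dist_dist.
have tau0 : tau 0 = 0.
  apply/le_anti; rewrite tau_ge0 andbT; apply: tau_le => // x _.
  by rewrite /w normr0 mul0r min_r ?mulr0 ?ler01.
have ctau : continuous tau.
  move=> t; have [->|t0] := eqVneq t 0.
    apply/cvgrPdist_le => e e0; rewrite tau0.
    have [d' d'0 kd'] := ko e0.
    near=> s; rewrite sub0r normrN ger0_norm//; apply: tau_le => [|x Ix].
      exact: ltW.
    have [nx0 nxd kx0] := Ix; have [nd'|nd'] := ltP (n x) d'.
      apply: (@le_trans _ _ (k x / n x)).
        by rewrite ler_piMr ?kn_ge0// ge_min lexx.
      by rewrite ler_pdivrMr// kd'.
    apply: (@le_trans _ _ (`|s| / n x)).
      rewrite /w (le_trans (ler_piMl _ _))//.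
      - by rewrite le_min ler01 divr_ge0// ltW.
      - by rewrite ler_pdivrMr// kd.
      - by rewrite ge_min lexx orbT.
    rewrite ler_pdivrMr//; apply: (@le_trans _ _ (e * d')).
      near: s; apply/nbhs_ballP; exists (e * d') => /=; first exact: mulr_gt0.
      by move=> s; rewrite /ball/= sub0r normrN => /ltW.
    by rewrite ler_pM2l.
  have nt0 : 0 < `|t| by rewrite normr_gt0.
  apply/cvgrPdist_le => e e0; near=> s.
  have ts : `|t| / 2 <= `|s|.
    near: s; apply/nbhs_ballP; exists (`|t| / 2) => /=; first exact: divr_gt0.
    move=> s; rewrite /ball/= => sts; have := ler_dist_dist t s.
    by move=> /(le_trans (ler_norm _)); lra.
  have st : `|t - s| <= e * (`|t| / 2).
    near: s; apply/nbhs_ballP; exists (e * (`|t| / 2)) => /=.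
      by rewrite mulr_gt0// divr_gt0.
    by move=> s; rewrite /ball/= => /ltW.
  have [tles|slet] := leP `|t| `|s|.
    rewrite (le_trans (tau_lip _ _ nt0 tles))// ler_pdivrMr//.
    by rewrite (le_trans st)// ler_pM2l//; lra.
  have s0 : 0 < `|s| by apply: lt_le_trans ts; rewrite divr_gt0.
  rewrite distrC (le_trans (tau_lip _ _ s0 (ltW slet)))// ler_pdivrMr//.
  by rewrite distrC (le_trans st)// ler_pM2l.
have [F F0 dF] := antiderivative ctau.
have cF a b : 0 <= a -> {within `[a, b], continuous F}.
  move=> a0; apply: continuous_in_subspaceT => x.
  rewrite inE/= in_itv/= => /andP[ax _].
  have [dFx _] := dF x (le_trans a0 ax).
  by apply: differentiable_continuous; apply/derivable1_diffP.
have F_ge t : 0 <= t -> t * tau t <= F (2 * t).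
  rewrite le_eqVlt => /predU1P[<-|t0]; first by rewrite mulr0 F0 mul0r.
  have [u] : exists2 u, u \in `]0, t[ & F t - F 0 = tau u * (t - 0).
    apply: MVT => //; last exact: cF.
    by move=> x; rewrite in_itv/= => /andP[/ltW x0 _]; exact: dF.
  rewrite in_itv/= => /andP[u0 ut]; rewrite F0 !subr0 => Ft.
  have t2 : t < 2 * t by lra.
  have [v] : exists2 v, v \in `]t, 2 * t[ &
      F (2 * t) - F t = tau v * (2 * t - t).
    apply: MVT => //; last exact/cF/ltW.
    move=> x; rewrite in_itv/= => /andP[tx _].
    by apply: dF; rewrite ltW// (lt_trans t0 tx).
  rewrite in_itv/= => /andP[tv v2]; have -> : 2 * t - t = t by ring.
  move=> /eqP; rewrite subr_eq => /eqP ->.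
  rewrite mulrC -[leLHS]addr0 lerD ?Ft ?mulr_ge0 ?(ltW t0)//.
  rewrite ler_pM2r// tau_mono// !gtr0_norm//; last exact: (lt_trans t0).
  exact: ltW.
exists (fun t => F (2 * t)), (fun t => 2 * tau (2 * t)); split.
- move=> t t0.
  have D2 : is_derive t 1 ( *%R (2:R)) 2.
    by apply: (@is_derive_eq _ _ _ (2 *: id) _ _ _ _); rewrite scaler1.
  have DF : is_derive (2 * t) 1 F (tau (2 * t)) by apply: dF; rewrite mulr_ge0.
  by have := is_derive1_comp DF D2; rewrite [X in is_derive _ _ _ X]mulrC.
- move=> t; apply: cvgM; first exact: cvg_cst.
  apply: continuous_comp; last exact: ctau.
  by apply: cvgM; [exact: cvg_cst|exact: cvg_id].
- by rewrite mulr0 tau0 mulr0.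
- by rewrite mulr0 F0.
exists d => // x nxd; have [nx0|] := ltP 0 (n x); last first.
  move=> nx0; have nxE : n x = 0 by apply/le_anti; rewrite nx0 n_ge0.
  by rewrite nxE mulr0 F0; have := kd x nxd; rewrite nxE mulr0.
apply: le_trans (F_ge _ (n_ge0 x)).
have [kx0|/ltW kx0] := leP 0 (k x); last by rewrite (le_trans kx0)// mulr_ge0.
have Ix : I x by split.
have := tau_ub (n x) x Ix; rewrite /w gtr0_norm// divff ?gt_eqF// minxx mulr1.
by rewrite ler_pdivrMr// mulrC.
Unshelve. all: by end_near. Qed.

End Modulus.

(** * Continuous linear maps and maps of class C^1 *)

Lemma clin_norm_le (R : realType) (E F : normedModType R) (f : clin E F) x :
  `|f x| <= `|f| * `|x|.
Proof. exact: le_opnorm. Qed.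

Lemma clinB (R : realType) (E F : normedModType R) (f g : clin E F) x :
  (f - g) x = f x - g x.
Proof. by []. Qed.

Lemma clin_predP (R : realType) (E F : normedModType R)
    (f : {linear E -> F}) (M : R) :
  (forall x, `|f x| <= M * `|x|) -> (f : E -> F) \in @clin_pred R E F.
Proof.
move=> fM; apply/asboolP; split; first exact: linearP.
apply/linear_bounded_continuous/linear_boundedP.
exists M; split; first exact: num_real.
by move=> r Mr x; rewrite (le_trans (fM x))// ler_wpM2r// ltW.
Qed.

Section Ck1.
Variables (R : realType) (E : normedModType R) (U : set E).
Implicit Types f g : E -> R^o.

Lemma Ck1_cst (a : R) : Ck 1 U (cst a : E -> R^o).
Proof.
exists (cst 0) => x _; last exact: cst_continuous.
exact: is_diff_cst.
Qed.

Lemma Ck1_clin (L : clin E R^o) : Ck 1 U (L : E -> R^o).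
Proof.
exists (cst L) => x _; last exact: cst_continuous.
have cL := @clin_continuous _ _ _ L.
split; first exact: linear_differentiable.
by rewrite diff_lin.
Qed.

Lemma Ck1D f g : Ck 1 U f -> Ck 1 U g -> Ck 1 U (f + g : E -> R^o).
Proof.
move=> [f' df cf] [g' dg cg]; exists (f' + g') => x Ux.
  by have ? := df x Ux; have ? := dg x Ux; exact: is_diffD.
by apply: cvgD; [exact: cf|exact: cg].
Qed.

Lemma Ck1N f : Ck 1 U f -> Ck 1 U (- f : E -> R^o).
Proof.
move=> [f' df cf]; exists (- f') => x Ux.
  by have ? := df x Ux; exact: is_diffN.
by apply: cvgN; exact: cf.
Qed.

Lemma Ck1_continuous (F : normedModType R) (f : E -> F) x :
  Ck 1 U f -> U x -> {for x, continuous f}.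
Proof.
move=> [f' df _] Ux; have [dfx _] := df x Ux.
exact: differentiable_continuous.
Qed.

Lemma Ck1M f g : Ck 1 U f -> Ck 1 U g -> Ck 1 U (fun x => f x * g x : R^o).
Proof.
move=> Cf Cg; have cf := Ck1_continuous Cf; have cg := Ck1_continuous Cg.
move: Cf Cg => [f' df cf'] [g' dg cg'].
exists (fun x => (f x : R) *: g' x + (g x : R) *: f' x) => x Ux.
  have dfx : is_diff x (f : E -> R) (f' x) := df x Ux.
  have dgx : is_diff x (g : E -> R) (g' x) := dg x Ux.
  exact: (is_diffM dfx dgx).
apply: cvgD; apply: cvgZ; [exact: cf|exact: cg'|exact: cg|exact: cf'].
Qed.

Lemma Ck1_comp (s s' : R -> R) f :
  (forall t, is_diff t (s : R -> R^o) ( *%R (s' t) : R -> R^o)) ->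
  continuous s' ->
  Ck 1 U f -> Ck 1 U (s \o f : E -> R^o).
Proof.
move=> ds cs Cf; have cf := Ck1_continuous Cf; case: Cf => f' df cf'.
exists (fun x => s' (f x) *: f' x) => x Ux.
  have dfx := df x Ux; have dsx := ds (f x).
  exact: (is_diff_comp dfx dsx).
apply: cvgZ; last exact: cf'.
by apply: continuous_comp; [exact: cf|exact: cs].
Qed.

End Ck1.

Section ClinComp.
Variables (R : realType) (E F G : normedModType R).

Fact clin_comp_pred (A : clin F G) (B : clin E F) :
  (A \o B : E -> G) \in @clin_pred R E G.
Proof.
apply: (@clin_predP _ _ _ (A \o B) (`|A| * `|B|)) => x /=.
rewrite -mulrA (le_trans (clin_norm_le _ _))// ler_wpM2l//.
exact: clin_norm_le.
Qed.

Definition clin_comp (A : clin F G) (B : clin E F) : clin E G :=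
  Clin (clin_comp_pred A B).

Lemma clin_comp_norm (A : clin F G) (B : clin E F) :
  `|clin_comp A B| <= `|A| * `|B|.
Proof.
apply: opnorm_le => x x1.
apply: (le_trans (clin_norm_le A (B x))); rewrite ler_wpM2l//.
by rewrite (le_trans (clin_norm_le B x))// ler_piMr.
Qed.

(** Composition is bilinear and bounded for the operator norms, hence jointly
    continuous. *)
Lemma clin_comp_cvg (T : Type) (U : set_system T) (FU : Filter U)
    (A : T -> clin F G) (B : T -> clin E F) (a : clin F G) (b : clin E F) :
  A t @[t --> U] --> a -> B t @[t --> U] --> b ->
  clin_comp (A t) (B t) @[t --> U] --> clin_comp a b.
Proof.
move=> Aa Bb.
have Ba : (fun t => `|B t|) @ U --> `|b| by exact: cvg_norm.
have dA : (fun t => `|A t - a|) @ U --> (0 : R).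
  suff : (fun t => `|A t - a|) @ U --> `|a - a| by rewrite subrr normr0.
  by apply: cvg_norm; apply: cvgB => //; exact: cvg_cst.
have dB : (fun t => `|B t - b|) @ U --> (0 : R).
  suff : (fun t => `|B t - b|) @ U --> `|b - b| by rewrite subrr normr0.
  by apply: cvg_norm; apply: cvgB => //; exact: cvg_cst.
have H : (fun t => `|A t - a| * `|B t| + `|a| * `|B t - b|) @ U --> (0 : R).
  have -> : (0 : R) = 0 * `|b| + `|a| * 0 by rewrite mul0r mulr0 addr0.
  by apply: cvgD; apply: cvgM => //; exact: cvg_cst.
apply/cvgrPdist_le => e e0; move/cvgrPdist_le : H => /(_ e e0).
apply: filterS => t; rewrite sub0r normrN ger0_norm ?addr_ge0 ?mulr_ge0//.
apply: le_trans.
have -> : clin_comp a b - clin_comp (A t) (B t) =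
    - (clin_comp (A t - a) (B t) + clin_comp a (B t - b)).
  apply/val_inj/funext => x.
  rewrite -[LHS]/(a (b x) - A t (B t x)).
  rewrite -[RHS]/(- (A t (B t x) - a (B t x) + a (B t x - b x))).
  by rewrite linearB /= addrA subrK opprB.
rewrite normrN (le_trans (ler_normD _ _))// lerD ?clin_comp_norm//.
Qed.

End ClinComp.

Lemma is_diff_clin_uniq (R : realType) (E F : normedModType R) (f : E -> F) x
    (A B : clin E F) :
  is_diff x f A -> is_diff x f B -> A = B.
Proof. by move=> [_ fA] [_ fB]; apply/val_inj; rewrite /= -fA -fB. Qed.

(** * Hilbert spaces *)

Section HilbertDot.
Variables (R : realType) (E : hilbertType R).
Implicit Types u v w : E.

Lemma hdotC u v : hdot u v = hdot v u.
Proof. by rewrite hermC /= expr0 mul1r. Qed.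

Lemma hdotDl u v w : hdot (u + v) w = hdot u w + hdot v w.
Proof. by rewrite linearDl. Qed.

Lemma hdotZl (a : R) u w : hdot (a *: u) w = a * hdot u w.
Proof. by rewrite linearZl_LR. Qed.

Lemma hdotDr u v w : hdot w (u + v) = hdot w u + hdot w v.
Proof. by rewrite linearDr. Qed.

Lemma hdotZr (a : R) u w : hdot w (a *: u) = a * hdot w u.
Proof. by rewrite linearZr_LR. Qed.

Lemma normDsqr u v : `|u + v| ^+ 2 = `|u| ^+ 2 + 2 * hdot u v + `|v| ^+ 2.
Proof. by rewrite -!hdotE !(hdotDl, hdotDr) (hdotC v u); ring. Qed.

(** Cauchy-Schwarz here is a consequence of the triangle inequality, as the
    norm is given beforehand: expand the square of |u + v|. *)
Lemma hdot_le u v : `|hdot u v| <= `|u| * `|v|.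
Proof.
suff le w : hdot u w <= `|u| * `|w|.
  rewrite ler_norml le andbT lerNl -mulN1r -hdotZr.
  by rewrite (le_trans (le _))// scaleN1r normrN.
have := normDsqr u w; have := ler_normD u w.
have := normr_ge0 (u + w); have := normr_ge0 u; have := normr_ge0 w.
move: `|u| `|w| `|u + w| => a b c; nra.
Qed.

Fact hdot_clin_pred (u : E) : (hdot u : E -> R^o) \in @clin_pred R E R^o.
Proof. by apply: (@clin_predP _ _ _ (hdot u) `|u|) => x; exact: hdot_le. Qed.

Definition hdotl (u : E) : clin E R^o := Clin (hdot_clin_pred u).

Lemma hdotl_le (u : E) : `|hdotl u| <= `|u|.
Proof.
apply: opnorm_le => x x1; rewrite (le_trans (hdot_le u x))//.
by rewrite ler_piMr.
Qed.

Fact hdotl_linear : linear hdotl.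
Proof.
by move=> b u v; apply/val_inj/funext => x; rewrite /= hdotDl hdotZl.
Qed.

HB.instance Definition _ :=
  GRing.isLinear.Build R E (clin E R^o) _ hdotl hdotl_linear.

Lemma hdotl_continuous : continuous hdotl.
Proof.
have := @clin_predP _ _ _ hdotl 1 => /(_ _)/asboolP[] // x.
by rewrite mul1r hdotl_le.
Qed.

End HilbertDot.

(** Apply the real mean value theorem to t |-> (w | f t) with w = f b - f a. *)
Lemma hilbert_mean_value (R : realType) (E : hilbertType R) (f f' : R -> E)
    (a b K : R) :
  a <= b -> 0 <= K ->
  (forall t, a <= t <= b -> is_diff t f (fun s => s *: f' t)) ->
  (forall t, a <= t <= b -> `|f' t| <= K) ->
  `|f b - f a| <= K * (b - a).
Proof.
move=> ab K0 df fK; set w := f b - f a.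
pose g (t : R) : R := hdot w (f t).
have dg t : a <= t <= b ->
    is_diff t (g : R -> R^o) (fun s => hdot w (s *: f' t)).
  move=> tab; have dft := df t tab.
  have dL : is_diff (f t) (hdotl w : E -> R^o) (hdotl w).
    have cL := @clin_continuous _ _ _ (hdotl w).
    by split; [exact: linear_differentiable|rewrite diff_lin].
  exact: (is_diff_comp dft dL).
have [c] : exists2 c, c \in `[a, b] & g b - g a = hdot w (f' c) * (b - a).
  apply: MVT_segment => //.
    move=> t /subset_itv_oo_cc; rewrite in_itv/= => tab.
    have [dgt gt] := dg t tab.
    split; first exact/derivable1_diffP.
    by rewrite deriveE// gt scale1r.
  apply: continuous_in_subspaceT => t; rewrite inE/= in_itv/= => tab.
  by have [dgt _] := dg t tab; exact: differentiable_continuous.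
rewrite in_itv/= => cab.
have -> : g b - g a = `|w| ^+ 2 by rewrite -hdotE /g -linearBr.
have [->|w0] := eqVneq w 0.
  by rewrite normr0 => _; rewrite mulr_ge0// subr_ge0.
have nw : 0 < `|w| by rewrite normr_gt0.
move=> wE; rewrite -(ler_pM2l nw) -expr2 wE mulrA ler_wpM2r ?subr_ge0//.
apply: (le_trans (ler_norm _)); apply: (le_trans (hdot_le _ _)).
by rewrite ler_wpM2l// fK.
Qed.

Section Distance.
Variables (R : realType) (E : hilbertType R) (a : E).

Lemma continuous_dist (x : E) : {for x, continuous (fun y => `|y - a|)}.
Proof. by apply: cvg_norm; apply: cvgB; [exact: cvg_id|exact: cvg_cst]. Qed.

Lemma continuous_hdotl_center (x : E) :
  {for x, continuous (fun y => hdotl (y - a))}.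
Proof.
apply: (@continuous_comp _ _ _ (fun y => y - a) (@hdotl R E)).
  by apply: cvgB; [exact: cvg_id|exact: cvg_cst].
exact: hdotl_continuous.
Qed.

Lemma is_diff_sqr_dist (x : E) :
  is_diff x (fun y => `|y - a| ^+ 2 : R^o) (2 *: hdotl (x - a)).
Proof.
apply: near_is_diff; first exact: clin_continuous.
move=> e e0; near=> y; have ye : `|y - x| <= e.
  near: y; apply/nbhs_ballP; exists e => //= y.
  by rewrite -ball_normE/= distrC => /ltW.
have -> : y - a = (x - a) + (y - x) by rewrite [RHS]addrC addrA subrK.
rewrite normDsqr -[X in `|_ - X|]/(2 * hdot (x - a) (y - x)).
rewrite [X in `|X|](_ : _ = `|y - x| * `|y - x|); last by ring.
by rewrite normrM !normr_id ler_wpM2r.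
Unshelve. all: by end_near. Qed.

Lemma Ck1_sqr_dist : Ck 1 setT (fun y => `|y - a| ^+ 2 : R^o).
Proof.
exists (fun x => 2 *: hdotl (x - a)) => x _; first exact: is_diff_sqr_dist.
by apply: cvgZl_tmp; exact: continuous_hdotl_center.
Qed.

(** The remainder has a closed form: with v = y - x, the quantity
    |x - a| * (|y - a| - |x - a|) - (x - a | v) is half of
    |v|^2 - (|y - a| - |x - a|)^2, so it lies between 0 and |v|^2 / 2. *)
Lemma is_diff_dist (x : E) : x != a ->
  is_diff x (fun y => `|y - a| : R^o) (`|x - a|^-1 *: hdotl (x - a)).
Proof.
move=> xa; have n0 : 0 < `|x - a| by rewrite normr_gt0 subr_eq0.
apply: near_is_diff; first exact: clin_continuous.
move=> e e0; near=> y; have ye : `|y - x| <= e * `|x - a|.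
  near: y; apply/nbhs_ballP; exists (e * `|x - a|) => /=; first exact: mulr_gt0.
  by move=> y; rewrite -ball_normE/= distrC => /ltW.
have yE : y - a = (x - a) + (y - x) by rewrite [RHS]addrC addrA subrK.
have := normDsqr (x - a) (y - x); rewrite -yE => nE.
have le1 : `| `|y - a| - `|x - a| | <= `|y - x|.
  rewrite (le_trans (ler_dist_dist _ _))//.
  by have -> : y - a - (x - a) = y - x by rewrite opprB addrA subrK.
have nM (c : R) : `|c| * `|x - a| = `|c * `|x - a| | by rewrite normrM normr_id.
rewrite -(ler_pM2r n0) [leLHS]nM.
rewrite [X in `|X|](_ : _ =
  (`|y - x| ^+ 2 - (`|y - a| - `|x - a|) ^+ 2) / 2); last first.
  rewrite -[X in (_ - X) * _]/(`|x - a|^-1 * hdot (x - a) (y - x)).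
  rewrite mulrBl mulrAC mulVf ?gt_eqF// mul1r.
  by move: nE; set d := hdot _ _; lra.
move: le1; rewrite ler_norml => /andP[l1 l2].
have := normr_ge0 (y - x).
rewrite ler_norml => v0; apply/andP; split; nra.
Unshelve. all: by end_near. Qed.

End Distance.

(** * A C^1 minorant of a differentiable function *)

Section Minorant.
Variables (R : realType) (E : hilbertType R) (a : E).

Let dist_center0 : (fun x => `|x - a|) @ a --> (0 : R).
Proof.
suff : (fun x => `|x - a|) @ a --> `|a - a| by rewrite subrr normr0.
exact: continuous_dist.
Qed.

Section RadialFunction.
Variables (sigma tau : R -> R).
Hypothesis dsigma : forall t : R, 0 <= t -> is_derive t 1 sigma (tau t).
Hypothesis ctau : continuous tau.
Hypothesis tau0 : tau 0 = 0.

(** The norm is not differentiable at the center, but the vanishing of tau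
    there makes the composite flat. *)
Lemma is_diff_radial_center :
  is_diff a (fun x => sigma `|x - a| : R^o) (0 : E -> R^o).
Proof.
apply: (@near_is_diff _ _ _ _ (0 : clin E R^o)); first exact: cst_continuous.
move=> e e0.
have d0 : is_diff (0:R) (sigma : R -> R^o) ( *%R 0 : R -> R^o).
  by have := is_derive_is_diff (dsigma (lexx 0)); rewrite tau0.
have cn := dist_center0.
have H : \forall x \near a, `|sigma `|x - a| - sigma 0 - 0 * (`|x - a| - 0)|
  <= e * `| `|x - a| - 0| := cn _ (is_diff_near d0 e0).
apply: filterS H => x /=.
by rewrite mul0r !subr0 normr_id subrr normr0.
Qed.

Lemma Ck1_radial : Ck 1 setT (fun x => sigma `|x - a| : R^o).
Proof.
(* At x = a the vector x - a vanishes, so the formula gives 0 there. *)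
exists (fun x => (tau `|x - a| / `|x - a|) *: hdotl (x - a)) => x _.
  have [->|xa] := eqVneq x a.
    rewrite subrr normr0 tau0 mul0r scale0r; exact: is_diff_radial_center.
  have dx := is_diff_dist xa.
  have ds := is_derive_is_diff (dsigma (normr_ge0 (x - a))).
  apply: (is_diff_eq (is_diff_comp dx ds)).
  by apply/funext => v /=; rewrite /GRing.scale/= mulrA.
have [->|xa] := eqVneq x a.
  apply/cvgrPdist_le => e e0; rewrite subrr normr0 tau0 mul0r scale0r.
  have cn := dist_center0.
  have ct : tau @ (0 : R) --> (0 : R) by rewrite -{2}tau0; exact: ctau.
  have H : \forall x \near a, `|0 - tau `|x - a| | <= e.
    have H0 : \forall t \near (0:R), `|0 - tau t| <= e.
      by move/cvgrPdist_le : ct; exact.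
    exact: (cn _ H0).
  apply: filterS H => y.
  rewrite !sub0r !normrN => te; apply: le_trans te.
  rewrite normrZ; apply: (le_trans (ler_wpM2l _ (hdotl_le _))) => //.
  have [->|n0] := eqVneq `|y - a| 0; first by rewrite mulr0.
  by rewrite -[X in _ * X]normr_id -normrM divfK.
apply: cvgZ; last exact: continuous_hdotl_center.
have cn : {for x, continuous (fun y => `|y - a|)} by exact: continuous_dist.
apply: cvgM; first by apply: continuous_comp; [exact: cn|exact: ctau].
by apply: cvgV; [rewrite normr_eq0 subr_eq0|exact: cn].
Qed.

End RadialFunction.

Definition bump (r : R) : E -> R^o :=
  fun x : E => (Num.max 0 (1 - r ^- 2 * `|x - a| ^+ 2) ^+ 2 : R).

Let quad (r : R) : E -> R^o := fun x : E => (1 - r ^- 2 * `|x - a| ^+ 2 : R).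

Lemma bump_center (r : R) : bump r a = 1.
Proof. by rewrite /bump subrr normr0 expr0n/= mulr0 subr0 max_r// expr1n. Qed.

Lemma bump_out (r : R) x : 0 < r -> r <= `|x - a| -> bump r x = 0.
Proof.
move=> r0 rx; rewrite /bump max_l ?expr0n// subr_le0 mulrC.
by rewrite ler_pdivlMr ?exprn_gt0// mul1r ler_sqr ?nnegrE ?(ltW r0).
Qed.

Let Ck1_quad r : Ck 1 setT (quad r).
Proof.
have C1 := Ck1_cst (setT : set E) (1 : R).
have Cr := Ck1_cst (setT : set E) (r ^- 2).
have H1 := Ck1M Cr (Ck1_sqr_dist a).
have H2 := Ck1N H1.
have H3 := Ck1D C1 H2.
by congr (Ck 1 _ _) : H3; apply/funext => x.
Qed.

Lemma Ck1_bump r : Ck 1 setT (bump r).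
Proof.
have cs : continuous (fun s : R => 2 * Num.max 0 s).
  move=> s; apply: cvgM; first exact: cvg_cst.
  by apply: (@continuous_max _ _ (cst 0) id); [exact: cvg_cst|exact: cvg_id].
have H := Ck1_comp (@is_diff_pos_sqr R) cs (Ck1_quad r).
exact: H.
Qed.

Lemma is_diff_bump_center r : is_diff a (bump r) (0 : E -> R^o).
Proof.
have dq : is_diff a (quad r) (0 : E -> R^o).
  have d1 := @is_diff_sqr_dist _ _ a a; rewrite subrr linear0 scaler0 in d1.
  have d2 : is_diff a (r ^- 2 *: (fun x => `|x - a| ^+ 2) : E -> R^o)
      (r ^- 2 *: 0).
    exact: is_diffZ.
  have d3 : is_diff a (cst (1 : R) : E -> R^o) 0 by exact: is_diff_cst.
  by apply: (is_diff_eq (is_diffB d3 d2)); rewrite scaler0 subrr.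
apply: (is_diff_eq (is_diff_comp dq (is_diff_pos_sqr _))).
by apply/funext => v /=; rewrite mulr0.
Qed.

(** The minorant is bump * (A - sigma (|x - a|)), where A is the affine part of
    h at a.  Multiplying by the cutoff changes A only to second order, so that
    bump * A - h is still o(|x - a|).  As bump >= 1/2 near a, it suffices that
    sigma dominates twice this remainder. *)
Lemma C1_minorant (h : E -> R^o) (r : R) : 0 < r -> differentiable h a ->
  exists psi : E -> R^o, [/\ Ck 1 setT psi,
    forall x, r <= `|x - a| -> psi x = 0,
    psi a = h a,
    'd psi a = 'd h a :> (E -> R^o) &
    \forall x \near a, psi x <= h x].
Proof.
move=> r0 dh.
have Lin : ('d h a : E -> R^o) \in @clin_pred R E R^o.
  by apply/asboolP; split; [exact: linearP|exact: diff_continuous].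
pose L : clin E R^o := Clin Lin.
pose A : E -> R^o := (L : E -> R^o) + (cst (h a - L a) : E -> R^o).
have Aa : A a = h a by rewrite /A fctE /= addrC subrK.
have C1A : Ck 1 setT A by apply: Ck1D; [exact: Ck1_clin|exact: Ck1_cst].
have dA : is_diff a A L.
  have dL : is_diff a (L : E -> R^o) L.
    have cL := @clin_continuous _ _ _ L.
    by split; [exact: linear_differentiable|rewrite diff_lin].
  have dc := is_diff_cst (h a - L a : R^o) a.
  by apply: (is_diff_eq (is_diffD dL dc)); rewrite addr0.
have db := is_diff_bump_center r.
have prod_diff (f : E -> R^o) df : is_diff a f df ->
    is_diff a (fun x => bump r x * f x : R^o) df.
  move=> dfa; have dfa' : is_diff a (f : E -> R) df := dfa.
  have db' : is_diff a (bump r : E -> R) (0 : E -> R) := db.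
  apply: (is_diff_eq (is_diffM db' dfa')).
  by rewrite bump_center scale1r scaler0 addr0.
have dB := prod_diff _ _ dA.
pose B (x : E) : R^o := bump r x * A x.
have dBh : is_diff a (B - h) (0 : E -> R^o).
  have dh' := differentiableP dh.
  by apply: (is_diff_eq (is_diffB dB dh')); rewrite subrr.
(* The absolute value guarantees sigma >= 0 where it dominates k. *)
pose k x : R := 2 * `|B x - h x|.
have Ba : B a = h a by rewrite /B bump_center mul1r Aa.
have ko e : 0 < e ->
    exists2 d, 0 < d & forall x, `|x - a| < d -> k x <= e * `|x - a|.
  move=> e0; have e2 : 0 < e / 2 by rewrite divr_gt0.
  have /nbhs_ballP[d /= d0 hd] := is_diff_near dBh e2.
  exists d => // x xd; have := hd x; rewrite -ball_normE/= distrC => /(_ xd).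
  rewrite !fctE Ba subrr !subr0 /k => H.
  by rewrite mulrC -ler_pdivlMr// mulrAC.
have [sigma [tau [dsigma ctau tau0 sigma0 [d d0 kd]]]] :=
  C1_modulus (fun x => normr_ge0 (x - a)) ko.
exists (fun x => bump r x * (A x - sigma `|x - a|)); split.
- apply: Ck1M; first exact: Ck1_bump.
  by apply: Ck1D => //; apply: Ck1N; exact: Ck1_radial.
- by move=> x rx; rewrite bump_out// mul0r.
- by rewrite bump_center mul1r subrr normr0 sigma0 subr0 Aa.
- have dr := is_diff_radial_center dsigma tau0.
  have dd : is_diff a (A - (fun x => sigma `|x - a|)) L.
    by apply: (is_diff_eq (is_diffB dA dr)); rewrite subr0.
  by have [_ ->] := prod_diff _ _ dd.
near=> x.
have b2 : 2^-1 <= bump r x.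
  near: x; have := Ck1_continuous (Ck1_bump r) (I : setT a).
  move=> /cvgrPdist_le/(_ 2^-1); rewrite invr_gt0 ltr0n bump_center => /(_ isT).
  apply: filterS => x /ler_normlW; have := splitr (1:R); rewrite mul1r; lra.
have xd : `|x - a| < d.
  near: x; apply/nbhs_ballP; exists d => //= x.
  by rewrite -ball_normE/= distrC.
have ks := kd x xd.
have s0 : 0 <= sigma `|x - a| by apply: le_trans ks; rewrite mulr_ge0.
have Bk : B x - h x <= k x / 2 by rewrite /k mulrAC mulfV// mul1r ler_norm.
have : 2^-1 * sigma `|x - a| <= bump r x * sigma `|x - a| by rewrite ler_wpM2r.
move: Bk ks; rewrite mulrBr -/(B x).
by move: (sigma _) (k x) (bump r x * _) (B x) (h x) => s K b B' h'; lra.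
Unshelve. all: by end_near. Qed.

End Minorant.

(** * Closures of small balls in charts *)

Lemma lipschitz_left_cvg (R : realType) (E : completeNormedModType R)
    (f : R -> E) (b K : R) : 0 < b -> 0 <= K ->
  (forall s t, 0 <= s -> s <= t -> t < b -> `|f t - f s| <= K * (t - s)) ->
  exists2 y, f t @[t --> b^'-] --> y & `|y - f 0| <= K * b.
Proof.
(* K may vanish, and the Cauchy estimate divides by the Lipschitz constant. *)
move=> b0 K0 fL; pose K1 := K + 1.
have K1_gt0 : 0 < K1 by rewrite ltr_wpDl.
have /cauchy_cvgP/cvg_ex[y fy] : cauchy (f t @[t --> b^'-]).
  apply/cauchy_ballP => e e0; near_simpl.
  pose u := Num.max 0 (b - e / (2 * K1)).
  have ub : u < b.
    by rewrite /u gt_max b0 ltrBlDr ltrDl divr_gt0// mulr_gt0.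
  have near_u : \forall t \near b^'-, u < t /\ t < b.
    near=> t; split; first by near: t; exact: nbhs_left_gt.
    by near: t; exact: nbhs_left_lt.
  have main s t : u < s -> s <= t -> t < b -> `|f t - f s| < e.
    move=> us st tb; have s0 : 0 <= s.
      by rewrite (le_trans _ (ltW us))// le_max lexx.
    apply: (le_lt_trans (fL s t s0 st tb)).
    have ts : t - s < e / (2 * K1).
      have : b - e / (2 * K1) < s.
        by rewrite (le_lt_trans _ us)// le_max lexx orbT.
      by lra.
    apply: (@le_lt_trans _ _ (K1 * (t - s))).
      by rewrite ler_wpM2r ?subr_ge0// lerDl.
    rewrite mulrC -ltr_pdivlMr//; apply: (lt_trans ts).
    by rewrite invfM mulrA ltr_pM2r ?invr_gt0//; lra.
  exists ((fun t => u < t /\ t < b), (fun t => u < t /\ t < b)) => //.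
  move=> [s t] [/= [us sb] [ut tb]]; rewrite -ball_normE/=.
  have [st|/ltW ts] := leP s t; last exact: main.
  by rewrite distrC; exact: main.
exists y => //.
have cn : `|f t - f 0| @[t --> b^'-] --> `|y - f 0|.
  by apply: cvg_norm; apply: cvgB => //; exact: cvg_cst.
apply: (cvgr_to_le cn); near=> t.
have tb : t < b by near: t; exact: nbhs_left_lt.
have t0 : 0 <= t by near: t; exact: nbhs_left_ge.
by rewrite (le_trans (fL 0 t _ _ _))// subr0 ler_wpM2l// ltW.
Unshelve. all: by end_near. Qed.

Lemma nbhs_dist (R : realType) (V : normedModType R) (x : V) (P : set V) :
  nbhs x P -> exists2 e : R, 0 < e & forall y, `|y - x| < e -> P y.
Proof.
move=> /nbhs_ballP[e /= e0 he]; exists e => // y yx; apply: he.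
by rewrite -ball_normE/= distrC.
Qed.

Section Regularity.
Variables (R : realType) (M : riemannian R).
Local Notation E := (model M).

(** The equivalence of norms on the single tangent space at p spreads, with
    uniform constants, to the nearby points, because the matrix G of the metric
    in the chart c is continuous for the operator norm.  The chart at the other
    point q is the same chart, packaged with a proof that q is in its domain. *)
Lemma metric_local_equiv (p : M) (c : chart_at p) : exists a b : R,
  [/\ 0 < a, 0 < b & \forall x \near c p, forall (q : M) (d : chart_at q),
    chart_of d = chart_of c -> d q = x -> forall v : tangent q,
    a * `|v d| ^+ 2 <= metric q v v <= b * `|v d| ^+ 2].
Proof.
have [ac cp] := svalP c.
have [G sG GE] := metric_smooth ac.
have [a0 [b0 [a0_gt0 _ a0P]]] := metric_equiv c.
have cG : {for (c p), continuous G}.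
  by apply: (sG 0%N); exists p.
pose e := a0 ^+ 2 / 2; have e0 : 0 < e by rewrite divr_gt0// exprn_gt0.
exists e, (`|G (c p)| + e); split => //.
  by rewrite ltr_wpDl.
have nearG : \forall x \near c p, `|G (c p) - G x| <= e.
  by move/cvgrPdist_le : cG; exact.
apply: filterS nearG => x Gx q d dc dq v.
have -> : metric q v v = G x (v d) (v d) by rewrite (GE q d dc) -dq dc.
set u := v d.
have Gp : a0 ^+ 2 * `|u| ^+ 2 <= G (c p) u u.
  have mp : metric p (tvec c u) (tvec c u) = G (c p) u u.
    by rewrite (GE p c erefl) tvecE.
  have mp0 : 0 <= metric p (tvec c u) (tvec c u).
    have [->|/neq0_dnorm_gt0/ltW//] := eqVneq (tvec c u) 0.
    by rewrite linear0r.
  have := a0P (tvec c u) => /andP[+ _]; rewrite tvecE => H.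
  rewrite -mp -exprMn -[leRHS](sqr_sqrtr mp0).
  by rewrite ler_sqr ?nnegrE ?sqrtr_ge0// mulr_ge0// ltW.
have bilin_le (H : clin E (clin E R^o)) (e' : R) : `|H| <= e' ->
    `|H u u| <= e' * `|u| ^+ 2.
  move=> He; rewrite expr2 mulrA (le_trans (clin_norm_le _ _))// ler_wpM2r//.
  by rewrite (le_trans (clin_norm_le _ _))// ler_wpM2r.
have Gle : `|G (c p) u u| <= `|G (c p)| * `|u| ^+ 2 by exact: bilin_le.
have Gdiff : `|G (c p) u u - G x u u| <= e * `|u| ^+ 2.
  by have := bilin_le _ _ Gx; rewrite !clinB.
move: Gp Gle Gdiff; rewrite !ler_norml => Gp /andP[g1 g2] /andP[g3 g4].
rewrite mulrDl; apply/andP; split; last by lra.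
by move: Gp; rewrite {1}(_ : a0 ^+ 2 = e + e) ?mulrDl; [lra|rewrite /e; lra].
Qed.

(** Suppose that q is outside the domain of c, d is a chart at q, and q' is
    close to q but c q' is close to c p.  Follow in the chart d the segment from
    q' to q, up to the first parameter s at which its image mu leaves the larger
    ball of c.  Before s the curve c o mu is Lipschitz, since the metric bounds
    the differential of c o d^-1 by K; so c (mu t) has a limit y as t tends to
    s, still in the larger ball, and y has to be c (mu s) by uniqueness of
    limits in M.  Hence mu has not left at s, a contradiction. *)
Lemma chart_separation (p : M) (c : chart_at p) : exists2 r : R, 0 < r &
  forall q, ~ cdom c q -> \forall q' \near q, cdom c q' -> r < `|c q' - c p|.
Proof.
have [ac cp] := svalP c.
have [a [b1 [a0 _ metc]]] := metric_local_equiv c.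
have cimg : \forall x \near c p, (c @` cdom c) x.
  by apply: open_nbhs_nbhs; split; [exact: cimg_open|exists p].
have [e e0 he] := nbhs_dist (filterI metc cimg).
have e2 : 0 < e / 2 by rewrite divr_gt0.
exists (e / 2) => // q cq.
pose d := some_chart q; have [ad dq] := svalP d.
have [a1 [b [_ b0 metd]]] := metric_local_equiv d.
have dimg : \forall x \near d q, (d @` cdom d) x.
  by apply: open_nbhs_nbhs; split; [exact: cimg_open|exists q].
have [e' e'0 he'] := nbhs_dist (filterI metd dimg).
pose K := Num.sqrt (b / a).
have K0 : 0 < K by rewrite sqrtr_gt0 divr_gt0.
have dcont : d q' @[q' --> q] --> d q by exact: cfun_continuous.
near=> q' => cq'; rewrite ltNge; apply/negP => q'e.
have dq' : cdom d q' by near: q'; exact: near_cdom.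
have we : `|d q - d q'| < e'.
  by near: q'; move/cvgrPdist_lt : dcont => /(_ _ e'0).
have Kw : K * `|d q - d q'| < e / 2.
  rewrite mulrC -ltr_pdivlMr//; near: q'; move/cvgrPdist_lt : dcont; apply.
  by rewrite divr_gt0.
set w := d q - d q' in we Kw.
pose gam (t : R) : E := d q' + t *: w.
pose mu t := cinv d (gam t).
have gam_in t : 0 <= t <= 1 -> `|gam t - d q| < e'.
  move=> /andP[t0 t1]; rewrite distrC /gam opprD addrA -/w.
  rewrite -{1}[w]scale1r -scalerBl normrZ (le_lt_trans _ we)//.
  by rewrite ler_piMl// ger0_norm; lra.
have mu_dom t : 0 <= t <= 1 -> cdom d (mu t) /\ d (mu t) = gam t.
  by move=> /gam_in/he'[_ [m dm mE]]; rewrite /mu -mE cfunK.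
have dgam (t : R) : is_diff t gam (fun s => s *: w).
  have H := is_diffD (is_diff_cst (d q' : E) t) (is_diff_scalel t w).
  by apply: (is_diff_eq H); rewrite add0r.
have gam_cont (t : R) : {for t, continuous gam}.
  by have [H _] := dgam t; exact: differentiable_continuous.
have mu_cont t : 0 <= t <= 1 -> {for t, continuous mu}.
  move=> t01; apply: continuous_comp; first exact: gam_cont.
  apply: cinv_continuous; have [? ?] := mu_dom t t01.
  by exists (mu t).
have mu0 : mu 0 = q' by rewrite /mu /gam scale0r addr0 cfunK.
have mu1 : mu 1 = q.
  by rewrite /mu /gam scale1r addrC subrK cfunK.
pose good m := cdom c m /\ `|c m - c p| < e.
have good_open m : good m -> \forall m' \near m, good m'.
  move=> [cm me]; near=> m'; split.
    by near: m'; apply: open_nbhs_nbhs; split => //; exact: cdom_open.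
  near: m'; have cc : c m' @[m' --> m] --> c m by exact: cfun_continuous.
  apply: (cvgr_norm_lt (c m - c p)) => //.
  by apply: cvgB => //; exact: cvg_cst.
pose phi (t : R) : E := c (mu t).
pose tr t : E := 'd (c \o cinv d) (gam t) w.
have trP t : 0 <= t <= 1 -> good (mu t) ->
    is_diff t phi (fun s => s *: tr t) /\ `|tr t| <= K * `|w|.
  move=> t01 [cm cme]; have [dm dmE] := mu_dom t t01.
  pose cc : chart_at (mu t) := exist _ (sval c) (conj ac cm).
  pose dd : chart_at (mu t) := exist _ (sval d) (conj ad dm).
  have D := transition_differentiable dd cc.
  rewrite [chart_of dd _]dmE in D.
  split.
    have D' := differentiableP D.
    apply: (is_diff_eq (is_diff_comp (dgam t) D')).
    by apply/funext => s /=; rewrite linearZ.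
  (* Read the squared length of the tangent vector w of the segment in both
     charts: the metric is the same, its two local expressions are not. *)
  have bgam := gam_in t t01; have [metg _] := he' _ bgam.
  have [metf _] := he _ cme.
  pose v := tvec dd w.
  have /andP[_ up] := metg (mu t) dd erefl dmE v.
  have /andP[low _] := metf (mu t) cc erefl erefl v.
  have := le_trans low up; rewrite [v dd]tvecE.
  have -> : v cc = tr t.
    by rewrite /v /tvec/= /tvec_coord /transition [chart_of dd _]dmE.
  move=> le2; rewrite -ler_sqr ?nnegrE ?mulr_ge0// ?(ltW K0)//.
  rewrite exprMn sqr_sqrtr; last by rewrite ltW// divr_gt0.
  by rewrite mulrAC ler_pdivlMr// mulrC.
(* The exit time s is the infimum of T; openness of good gives good (mu t)
   slightly beyond s as soon as it holds at s. *)
pose T := [set t : R | 0 <= t <= 1 /\ ~ good (mu t)].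
have T1 : T 1 by split; [rewrite ler01 lexx|rewrite mu1 => -[]].
have infT : has_inf T.
  by split; [exists 1|exists 0 => t [/andP[]]].
set s := inf T.
have s0 : 0 <= s by apply: lb_le_inf; [exists 1|move=> t [/andP[]]].
have s1 : s <= 1 by apply: ge_inf => //; case: infT.
have goodlt t : 0 <= t -> t < s -> good (mu t).
  move=> t0 ts; apply: contrapT => bad.
  have : s <= t by apply: ge_inf; [case: infT|split; [lra|]].
  by rewrite leNgt ts.
suff gs : good (mu s).
  have cs : {for s, continuous mu} by apply: mu_cont; lra.
  have [x x0 hx] := nbhs_dist (cs _ (good_open _ gs)).
  have [t [t01 bad] tx] := inf_adherent x0 infT.
  have st : s <= t by apply: ge_inf; [case: infT|split].
  apply: bad; apply: hx; rewrite ger0_norm ?subr_ge0//.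
  by rewrite -/s in tx; lra.
have good0 : good (mu 0) by rewrite mu0; split => //; lra.
have [s_eq0|s_neq0] := eqVneq s 0; first by rewrite s_eq0.
have s_gt0 : 0 < s by rewrite lt_neqAle eq_sym s_neq0 s0.
have philip u t : 0 <= u -> u <= t -> t < s ->
    `|phi t - phi u| <= K * `|w| * (t - u).
  move=> u0 ut ts.
  have ok x : u <= x <= t -> 0 <= x <= 1 /\ good (mu x).
    by move=> uxt; split; [lra|apply: goodlt; lra].
  apply: (@hilbert_mean_value _ _ phi tr) => //.
  - by rewrite mulr_ge0// ltW.
  - by move=> x /ok[x01 gx]; have [] := trP x x01 gx.
  - by move=> x /ok[x01 gx]; have [] := trP x x01 gx.
have Kw0 : 0 <= K * `|w| by rewrite mulr_ge0// ltW.
have [y phiy yle] := lipschitz_left_cvg s_gt0 Kw0 philip.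
have ye : `|y - c p| < e.
  have -> : y - c p = (y - phi 0) + (phi 0 - c p) by rewrite addrA subrK.
  rewrite (le_lt_trans (ler_normD _ _))//.
  have : `|phi 0 - c p| <= e / 2 by rewrite /phi mu0.
  have : K * `|w| * s <= K * `|w| by rewrite ler_piMr.
  by lra.
have [m cm my] : (c @` cdom c) y.
  by have [] := he y ye.
suff -> : mu s = m by split => //; rewrite my.
have lim1 : mu t @[t --> s^'-] --> mu s.
  by apply: cvg_at_left_filter; apply: mu_cont; lra.
have lim2 : cinv c (phi t) @[t --> s^'-] --> m.
  have cy : cinv c x @[x --> y] --> m.
    by rewrite -(cfunK cm) my; apply: cinv_continuous; exists m.
  exact: (cvg_comp _ _ phiy cy).
have lim3 : mu t @[t --> s^'-] --> m.
  apply: cvg_trans lim2; apply: near_eq_cvg; near=> t.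
  rewrite /phi cfunK//; have [] // : good (mu t).
  apply: goodlt; first by near: t; exact: nbhs_left_ge.
  by near: t; exact: nbhs_left_lt.
exact: (cvg_unique (@points_hausdorff R M) lim1 lim3).
Unshelve. all: by end_near. Qed.

End Regularity.

(** * Subdifferentials of compositions *)

Section Extension.
Variables (R : realType) (M : riemannian R) (p : M) (c : chart_at p).
Local Notation E := (model M).

Definition chart_extend (psi : E -> R) (q : M) : R :=
  if `[< cdom c q >] then psi (c q) else 0.

Lemma chart_extend_in psi q : cdom c q -> chart_extend psi q = psi (c q).
Proof. by rewrite /chart_extend => /asboolT ->. Qed.

(** At a point outside the domain of c, the separation hypothesis makes the
    extension vanish on a whole neighbourhood: there the points of the domain of
    c have coordinates at distance more than r from c p. *)
Lemma mC1_chart_extend (r : R) (psi : E -> R) :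
  (forall q, ~ cdom c q ->
     \forall q' \near q, cdom c q' -> r < `|c q' - c p|) ->
  Ck 1 setT (psi : E -> R^o) ->
  (forall x, r <= `|x - c p| -> psi x = 0) ->
  mC1 (chart_extend psi).
Proof.
move=> sep [psi' dpsi cpsi] psi0 d ad; have [ac cp] := svalP c.
have [F' dF cF] := atlas_smooth ad ac 1.
set F := chart_of c \o cinv d in dF.
have psi'0 x : r < `|x - c p| -> psi' x = 0.
  move=> rx; apply: (is_diff_clin_uniq (dpsi x I)).
  have near0 : {near x, cst 0 =1 (psi : E -> R^o)}.
    have cx : `|y - c p| @[y --> x] --> `|x - c p|.
      by apply: cvg_norm; apply: cvgB => //; exact: cvg_cst.
    near=> y; rewrite psi0//; near: y.
    by apply: (cvgr_ge _ cx).
  have := near_eq_is_diff near0 (differentiable_cst _ _).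
  by rewrite diff_cst.
pose f' (x : E) : clin E R^o :=
  if `[< cdom c (cinv d x) >] then clin_comp (psi' (F x)) (F' x) else 0.
have f'_in x : cdom c (cinv d x) -> f' x = clin_comp (psi' (F x)) (F' x).
  by rewrite /f' => /asboolT ->.
have f'_out x : (cdom c (cinv d x) -> r < `|c (cinv d x) - c p|) -> f' x = 0.
  rewrite /f'; case: asboolP => // cx /(_ cx) rx; rewrite psi'0//.
  by apply/val_inj/funext => v.
have inside q : cdom d q -> cdom c q -> [/\ is_diff (d q) F (F' (d q)),
    {for (d q), continuous F'} & \forall y \near d q, cdom c (cinv d y)].
  move=> dq cq; have Wq : (d @` (cdom d `&` cdom c)) (d q) by exists q.
  split; [exact: dF|exact: cF|].
  pose dd : chart_at q := exist _ d (conj ad dq).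
  apply: (near_chart dd); apply: open_nbhs_nbhs; split => //; exact: cdom_open.
have outside q : cdom d q -> ~ cdom c q -> \forall y \near d q,
    cdom c (cinv d y) -> r < `|c (cinv d y) - c p|.
  move=> dq cq; pose dd : chart_at q := exist _ d (conj ad dq).
  exact: (near_chart dd (sep q cq)).
exists f' => _ [q dq <-].
  have [cq|cq] := pselect (cdom c q).
    have [dFq _ nearc] := inside q dq cq.
    have dpF := is_diff_comp dFq (dpsi (F (d q)) I).
    have eqF : {near d q, (psi : E -> R^o) \o F =1 chart_extend psi \o cinv d}.
      by apply: filterS nearc => y cy /=; rewrite chart_extend_in.
    have H := near_eq_is_diff eqF (@ex_diff _ _ _ _ _ _ _ dpF).
    apply: (is_diff_eq H); rewrite f'_in ?cfunK//.
    exact: diff_val.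
  have eq0 : {near d q, cst (0 : R^o) =1 chart_extend psi \o cinv d}.
    apply: filterS (outside q dq cq) => y ry /=; rewrite /chart_extend.
    by case: asboolP => // cy; rewrite psi0// ltW// ry.
  have H := near_eq_is_diff eq0 (differentiable_cst _ _).
  by apply: (is_diff_eq H); rewrite f'_out ?cfunK// diff_cst.
have [cq|cq] := pselect (cdom c q).
  have [dFq cF'q nearc] := inside q dq cq.
  have cFq : {for (d q), continuous F}.
    by have [H _] := dFq; exact: differentiable_continuous.
  rewrite /prop_for /continuous_at f'_in ?cfunK//.
  have H : clin_comp (psi' (F y)) (F' y) @[y --> d q] -->
      clin_comp (psi' (F (d q))) (F' (d q)).
    apply: clin_comp_cvg => //; apply: (continuous_comp cFq); exact: cpsi.
  apply: cvg_trans H; apply: near_eq_cvg.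
  by apply: filterS nearc => y cy; rewrite f'_in.
rewrite /prop_for /continuous_at f'_out; last by rewrite cfunK.
have H : cst (0 : clin E R^o) @ d q --> (0 : clin E R^o) by exact: cvg_cst.
apply: cvg_trans H; apply: near_eq_cvg.
by apply: filterS (outside q dq cq) => y ry; rewrite f'_out.
Unshelve. all: by end_near. Qed.

End Extension.

Section Touching.
Variables (R : realType) (M : riemannian R) (p : M) (c : chart_at p).
Local Notation E := (model M).

Lemma C1_touching_below (h : M -> R) :
  differentiable (h \o cinv c : E -> R^o) (c p) ->
  exists psi : M -> R, [/\ mC1 psi, psi p = h p,
    \forall q \near p, psi q <= h q &
    forall v : tangent p,
      sdiff psi p v = 'd (h \o cinv c : E -> R^o) (c p) (v c)].
Proof.
move=> dh; have [r r0 sep] := chart_separation c; have [_ cp] := svalP c.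
have [psi [C1psi psi0 psip dpsi psih]] := C1_minorant r0 dh.
have C1 := mC1_chart_extend sep C1psi psi0.
exists (chart_extend c psi); split => //.
- by rewrite chart_extend_in// psip /= cfunK.
- have cc : c q @[q --> p] --> c p by exact: cfun_continuous.
  have nearh : \forall q \near p, psi (c q) <= h (cinv c (c q)) := cc _ psih.
  near=> q; have cq : cdom c q by near: q; exact: near_cdom.
  by rewrite chart_extend_in// -{2}(cfunK cq); near: q.
move=> v; apply: (etrans (sdiffE v c C1)).
apply: etrans (congr1 (@^~ (v c)) dpsi).
have [psi' dpsi' _] := C1psi; have [dp _] := dpsi' (c p) I.
have eqp : {near c p, (psi : E -> R^o) =1 chart_extend c psi \o cinv c}.
  have cimg : \forall x \near c p, (c @` cdom c) x.
    by apply: open_nbhs_nbhs; split; [exact: cimg_open|exists p].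
  by apply: filterS cimg => _ [q cq <-] /=; rewrite cfunK// chart_extend_in.
have H := near_eq_is_diff eqp dp.
exact: (congr1 (@^~ (v c)) (@diff_val _ _ _ _ _ _ _ H)).
Unshelve. all: by end_near. Qed.

End Touching.

(** The chain rule through a chart d at g p: phi o g is near p the composite of
    the local expressions of phi and g. *)
Lemma mC1_comp_diff (R : realType) (M N : manifold R) (g : M -> N)
    (phi : N -> R) (p : M) (c : chart_at p) : mC1 phi -> mdifferentiable g p ->
  differentiable (phi \o g \o cinv c : model M -> R^o) (c p) /\
  forall v : tangent p, sdiff phi (g p) (mdiff g p v) =
    'd (phi \o g \o cinv c : model M -> R^o) (c p) (v c).
Proof.
move=> Cphi dg; have [gc dgc] := dg; have [_ cp] := svalP c.
pose d := some_chart (g p); have [ad dp] := svalP d.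
have [phi' dphi _] := Cphi _ ad.
have [dph _] := dphi (d (g p)) (ex_intro2 _ _ (g p) dp erefl).
have ep : (d \o g \o cinv c) (c p) = d (g p) by rewrite /= cfunK.
have eqh : {near c p, ((phi \o cinv d : model N -> R^o) \o (d \o g \o cinv c))
    =1 (phi \o g \o cinv c : model M -> R^o)}.
  have gd : \forall q \near p, cdom d (g q) by exact: gc (near_cdom d).
  by apply: filterS (near_chart c gd) => x dx /=; rewrite cfunK.
split.
  have dph' : differentiable (phi \o cinv d : model N -> R^o)
      ((d \o g \o cinv c) (c p)) by rewrite ep.
  have [//] := near_eq_is_diff eqh (differentiable_comp (dgc c d) dph').
move=> v; rewrite (sdiffE _ d Cphi) (mdiffE v c d dg).
by apply/esym/(near_diff_comp _ ep (dgc c d) dph eqh).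
Qed.

(** The function phi touching f from below at g p is pulled back to phi o g, and
    then replaced by a C^1 function psi touching phi o g from below at p. *)
Lemma subdifferential_comp (R : realType) (M N : riemannian R)
    (g : M -> N) (f : N -> \bar R) (p : M) : f (g p) \is a fin_num ->
  mdifferentiable g p ->
  [set zeta \o mdiff g p | zeta in subdifferential f (g p)]
    `<=` subdifferential (f \o g) p.
Proof.
move=> ffin dg _ [zeta [phi [Cphi phif ->]] <-].
pose c := some_chart p.
have [dh hE] := mC1_comp_diff c Cphi dg.
have [psi [Cpsi psip psih psiE]] := C1_touching_below dh.
exists psi; split => //; last first.
  by apply/funext => v /=; rewrite hE psiE.
have gphi : \forall q \near p,
    (f (g p) - (phi (g p))%:E <= f (g q) - (phi (g q))%:E)%E.
  by have [gc _] := dg; exact: (gc _ phif).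
near=> q.
have pq : psi q <= phi (g q) by near: q.
have : (f (g p) - (phi (g p))%:E <= f (g q) - (phi (g q))%:E)%E by near: q.
rewrite /= psip /= -(fineK ffin); case: (f (g q)) => [y||] //=.
  by rewrite -!EFinB !lee_fin; lra.
Unshelve. all: by end_near. Qed.

Theorem proposition4p9 (R : realType) (M N : riemannian R)
    (g : M -> N) (f : N -> \bar R) (p : M) :
  (forall y, (-oo < f y)%E) ->
  subdifferentiable f (g p) ->
  mdifferentiable g p ->
  subdifferentiable (f \o g) p /\
  [set zeta \o mdiff g p | zeta in subdifferential f (g p)]
    `<=` subdifferential (f \o g) p.
Proof.
move=> fNy [fy [zeta fzeta]] dg.
have ffin : f (g p) \is a fin_num by rewrite fin_numElt fNy.
have sub := subdifferential_comp ffin dg.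
split => //; split => //.
by exists (zeta \o mdiff g p); apply: sub; exists zeta.
Qed.
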